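(* Let $r\ge2$ and let $\mathcal{RW}^m_1=(J\times N^{m-1}(c),g_f)$ be a Robertson-Walker space-time. Let $\gamma:I\to\mathcal{RW}^m_1$ be a curve parametrized by the arc length of the form $\gamma(s)=(t_0,\alpha(s))$, where $t_0$ is a fixed value in $J$ such that $f'(t_0)=0$. Then $\gamma(s)$ is $r$-harmonic in $\mathcal{RW}^m_1$ if and only if $\beta(s)=\alpha(f(t_0)\,s)$ is $r$-harmonic in $N^{m-1}(c)$.
   Context: A Robertson-Walker space-time is $\mathcal{RW}^m_1=(J\times N^{m-1}(c),g_f)$, where $J$ is a real open interval, $(N^{m-1}(c),g)$ is a Riemannian $(m-1)$-dimensional space form of constant sectional curvature $c$, $f$ is a smooth positive function on $J$, and $g_f=-dt^2+f^2(t)\,g$ (a Lorentzian metric). For a (semi-)Riemannian manifold with Levi-Civita connection $\nabla$, $R(X,Y)Z=\nabla_X\nabla_YZ-\nabla_Y\nabla_XZ-\nabla_{[X,Y]}Z$. For a nonnull smooth curve $\gamma$ parametrized by arc length, $T=\gamma'$, $\nabla_T^0T=T$, $\nabla_T^jT=\nabla_T(\nabla_T^{j-1}T)$; for $r\ge2$, $\gamma$ is $r$-harmonic if $$\tau_r(\gamma)=\nabla^{2r-1}_T T+\sum_{\ell=0}^{r-2}(-1)^\ell R\big(\nabla^{2r-3-\ell}_T T,\nabla^{\ell}_T T\big)T=0.$$ The curve $\beta$ is defined for those $s$ with $f(t_0)s\in I$. *)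

(* Defs.v *)
From HB Require Import structures.
From mathcomp Require Import all_boot all_order all_algebra.
From mathcomp Require Import all_classical all_reals all_analysis.

Set Implicit Arguments.
Unset Strict Implicit.
Unset Printing Implicit Defensive.

Import Order.TTheory GRing.Theory Num.Theory.
Import numFieldNormedType.Exports.

Local Open Scope classical_set_scope.
Local Open Scope ring_scope.

(* Only used with finite-dimensional V and W and open U, where C^k is
   equivalent to the existence and continuity of all iterated directional
   derivatives of order at most k. *)
Fixpoint Ck_on (R : realType) (V W : normedModType R) (k : nat) (U : set V)
    (F : V -> W) : Prop :=
  (forall x, U x -> {for x, continuous F}) /\
  (if k is k'.+1 then
     forall v : V, (forall x, U x -> derivable F x v) /\
       Ck_on k' U (fun x => 'D_v F x)
   else True).

Definition smooth_on (R : realType) (V W : normedModType R) (U : set V)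
    (F : V -> W) : Prop := forall k, Ck_on k U F.

(* A manifold with a metric is given by an atlas whose charts have their domains
   in an ambient space T; the underlying manifold is the union [carrier] of the
   domains. [coord i] is meaningful on [dom i], [param i] (the inverse of
   [coord i]) and [metric i] (the Gram matrix of the metric in the coordinate
   frame) on [cimage i]. *)
Record metric_atlas (R : realType) (T : topologicalType) (n : nat) := MetricAtlas {
  index : Type;
  dom : index -> set T;
  coord : index -> T -> 'rV[R]_n;
  param : index -> 'rV[R]_n -> T;
  metric : index -> 'rV[R]_n -> 'M[R]_n }.

Definition carrier (R : realType) (T : topologicalType) (n : nat)
    (M : metric_atlas R T n) : set T := \bigcup_(i in [set: index M]) dom i.

Definition cimage (R : realType) (T : topologicalType) (n : nat)
    (M : metric_atlas R T n) (i : index M) : set 'rV[R]_n := coord i @` dom i.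

Definition inner (R : realType) (n : nat) (g : 'M[R]_n) (u v : 'rV[R]_n) : R :=
  (u *m g *m v^T) 0 0.

Definition transition (R : realType) (T : topologicalType) (n : nat)
    (M : metric_atlas R T n) (i j : index M) : 'rV[R]_n -> 'rV[R]_n :=
  coord j \o param i.

Definition smooth_manifold (R : realType) (T : topologicalType) (n : nat)
    (M : metric_atlas R T n) : Prop :=
  [/\ hausdorff_space T,
      @second_countable T,
      (forall i : index M,
         [/\ open (dom i), open (cimage i),
             (forall p, dom i p -> param i (coord i p) = p),
             (forall p, dom i p -> {for p, continuous (coord i)})
           & (forall x, cimage i x -> {for x, continuous (param i)})])
    & (forall i j : index M,
         smooth_on (coord i @` (dom i `&` dom j)) (transition i j))].

(* The last clause says that the Gram matrices define one tensor: the metric in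
   chart i is the pullback by the transition map of the metric in chart j. *)
Definition riemannian_metric (R : realType) (T : topologicalType) (n : nat)
    (M : metric_atlas R T n) : Prop :=
  [/\ (forall (i : index M) (a b : 'I_n),
         smooth_on (cimage i) (fun x => metric i x a b : R)),
      (forall (i : index M) x, cimage i x -> (metric i x)^T = metric i x),
      (forall (i : index M) x (u : 'rV[R]_n), cimage i x -> u != 0 ->
         0 < inner (metric i x) u u)
    & (forall (i j : index M) x (u v : 'rV[R]_n),
         (coord i @` (dom i `&` dom j)) x ->
         inner (metric i x) u v =
         inner (metric j (transition i j x))
           ('D_u (transition i j) x) ('D_v (transition i j) x))].

Section Connection.
Variables (R : realType) (n : nat) (g : 'rV[R]_n -> 'M[R]_n).

Definition dmetric (l a b : 'I_n) (x : 'rV[R]_n) : R :=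
  'D_(delta_mx 0 l) (fun y => g y a b : R) x.

Definition christoffel (k a b : 'I_n) (x : 'rV[R]_n) : R :=
  2^-1 * \sum_l invmx (g x) k l *
    (dmetric a b l x + dmetric b a l x - dmetric l a b x).

Definition christoffel_form (x u v : 'rV[R]_n) : 'rV[R]_n :=
  \row_k \sum_a \sum_b christoffel k a b x * u 0 a * v 0 b.

(* Levi-Civita connection on vector fields of the coordinate domain *)
Definition nabla (X Y : 'rV[R]_n -> 'rV[R]_n) (x : 'rV[R]_n) : 'rV[R]_n :=
  'D_(X x) Y x + christoffel_form x (X x) (Y x).

Definition bracket (X Y : 'rV[R]_n -> 'rV[R]_n) (x : 'rV[R]_n) : 'rV[R]_n :=
  'D_(X x) Y x - 'D_(Y x) X x.

Definition riem (X Y Z : 'rV[R]_n -> 'rV[R]_n) (x : 'rV[R]_n) : 'rV[R]_n :=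
  nabla X (nabla Y Z) x - nabla Y (nabla X Z) x - nabla (bracket X Y) Z x.

(* By tensoriality, R(u,v)w at x may be computed with any extension of u, v, w
   to vector fields; we take those with constant components. *)
Definition curv (x u v w : 'rV[R]_n) : 'rV[R]_n :=
  riem (fun _ => u) (fun _ => v) (fun _ => w) x.

Definition sectional (x u v : 'rV[R]_n) : R :=
  inner (g x) (curv x u v v) u /
  (inner (g x) u u * inner (g x) v v - inner (g x) u v ^+ 2).

End Connection.

Section Curves.
Variables (R : realType) (T : topologicalType) (n : nat).
Variables (M : metric_atlas R T n) (I : set R) (y : R -> T).

Definition smooth_curve : Prop :=
  (forall s, I s -> carrier M (y s) /\ {for s, continuous y}) /\
  (forall i : index M,
     smooth_on (I `&` y @^-1` dom i) (coord i \o y : R -> 'rV[R]_n)).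

Definition velocity (i : index M) : R -> 'rV[R]_n := derive1 (coord i \o y : R -> 'rV[R]_n).

Definition nabla_along (i : index M) (V : R -> 'rV[R]_n) : R -> 'rV[R]_n :=
  fun s => derive1 V s + christoffel_form (metric i) (coord i (y s)) (velocity i s) (V s).

Definition nablaT (i : index M) (j : nat) : R -> 'rV[R]_n :=
  iter j (nabla_along i) (velocity i).

(* The value 1 or -1 depends on the causal character of the nonnull curve. *)
Definition arc_length : Prop :=
  forall s, I s -> forall i : index M, dom i (y s) ->
    `|inner (metric i (coord i (y s))) (velocity i s) (velocity i s)| = 1.

Definition tension (r : nat) (i : index M) (s : R) : 'rV[R]_n :=
  nablaT i (2 * r - 1)%N s +
  \sum_(0 <= l < r.-1) (-1) ^+ l *:
    curv (metric i) (coord i (y s))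
      (nablaT i (2 * r - 3 - l)%N s) (nablaT i l s) (velocity i s).

Definition r_harmonic (r : nat) : Prop :=
  [/\ smooth_curve, arc_length &
      forall s, I s -> forall i : index M, dom i (y s) -> tension r i s = 0].

Definition geodesic : Prop :=
  smooth_curve /\
  (forall s, I s -> forall i : index M, dom i (y s) -> nablaT i 1 s = 0).

End Curves.

Definition geodesically_complete (R : realType) (T : topologicalType) (n : nat)
    (M : metric_atlas R T n) : Prop :=
  forall (i : index M) (p : T) (v : 'rV[R]_n), dom i p ->
    exists y : R -> T,
      [/\ geodesic M setT y, y 0 = p & velocity y i 0 = v].

Definition space_form (R : realType) (T : topologicalType) (n : nat)
    (M : metric_atlas R T n) (c : R) : Prop :=
  [/\ carrier M = setT /\ smooth_manifold M,
      riemannian_metric M,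
      connected [set: T],
      geodesically_complete M
    & (forall (i : index M) x (u v : 'rV[R]_n), cimage i x ->
         row_free (col_mx u v) -> sectional (metric i) x u v = c)].

(* J x N sits in the ambient space R x T. A chart x of N gives the chart
   (t, p) |-> (t, x(p)), in which -dt^2 + f(t)^2 g is block diagonal. *)
Definition robertson_walker (R : realType) (T : topologicalType) (n : nat)
    (J : set R) (N : metric_atlas R T n) (f : R -> R) :
    metric_atlas R (R * T)%type (1 + n)%N :=
  {| index := index N;
     dom i := J `*` dom i;
     coord i q := row_mx (const_mx q.1) (coord i q.2);
     param i x := (lsubmx x 0 0, param i (rsubmx x));
     metric i x := block_mx (-1)%:M 0 0
                     (f (lsubmx x 0 0) ^+ 2 *: metric i (rsubmx x)) |}.

(* Main.v *)
(* On the slice t = t0, f'(t0) = 0 kills the Christoffel symbols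
   Gamma^0_ab = f f' g_ab (a, b spatial), and rescaling g by the constant
   f(t0)^2 does not change Gamma^k_ab; no others act on tangential fields.
   Hence covariant derivatives and curvature of fields tangent to the slice are
   those of N, and tau_r(gamma) = (0, tau_r(alpha)). Each nabla_T^j T is
   homogeneous of degree j + 1 under s |-> f(t0) s, so
   tau_r(beta)(s) = f(t0)^(2r) tau_r(alpha)(f(t0) s), and the factor f(t0)^2 in
   the metric on the slice makes beta parametrized by arc length. *)
Require Import Defs.
From HB Require Import structures.
From mathcomp Require Import all_boot all_order all_algebra.
From mathcomp Require Import all_classical all_reals all_analysis.
From mathcomp Require Import ring zify.
Import Order.TTheory GRing.Theory Num.Theory.
Import numFieldNormedType.Exports.
Local Open Scope classical_set_scope.
Local Open Scope ring_scope.

(** * Limits and directional derivatives under affine maps and rescalings *)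

Lemma cvg_mx {R : realType} {X : Type} {F : set_system X} {FF : Filter F}
    {m n : nat} (q : X -> 'M[R]_(m, n)) (l : 'M[R]_(m, n)) :
  (forall i j, q x i j @[x --> F] --> l i j) -> q x @[x --> F] --> l.
Proof.
move=> ql A [P lP PA]; rewrite /nbhs /=.
suff : \forall x \near F, forall i j, P i j (q x i j).
  by apply: filterS => x /PA.
have H i : \forall x \near F, forall j, P i j (q x i j).
  by apply: filter_forall => j; exact: ql (lP i j).
exact: filter_forall H.
Qed.

Lemma continuous_row_mx0 {R : realType} {m n : nat} :
  continuous (row_mx (0 : 'rV[R]_m) : 'rV_n -> 'rV_(m + n)).
Proof.
move=> x; apply: (@cvg_mx _ _ (nbhs x) _) => i j; case: (split_ordP j) => k ->.
  rewrite row_mxEl mxE.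
  under eq_fun do rewrite row_mxEl mxE.
  exact: cvg_cst.
rewrite row_mxEr; under eq_fun do rewrite row_mxEr.
exact: coord_continuous.
Qed.

Lemma continuous_rsubmx {R : realType} {m n : nat} :
  continuous (@rsubmx R 1 m n).
Proof.
move=> x; apply: (@cvg_mx _ _ (nbhs x) _) => i j; rewrite mxE.
under eq_fun do rewrite mxE.
exact: coord_continuous.
Qed.

Lemma eq_lim {R : realType} {X : Type} {F : set_system X} {V : normedModType R}
    (p q : X -> V) : p =1 q -> lim (p x @[x --> F]) = lim (q x @[x --> F]).
Proof. by move=> /funext ->. Qed.

(* No convergence is assumed: a divergent limit has the junk value [point],
   which is 0 in R and in row vectors. This is why the rules for derivatives
   below need no differentiability hypothesis, so that the covariant derivatives
   of a curve never have to be shown smooth. *)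
Lemma lim_section {R : realType} {X : Type} {F : set_system X}
    {FF : ProperFilter F} {V W : normedModType R} (L : V -> W) (K : W -> V)
    (q : X -> V) :
  continuous L -> continuous K -> cancel L K -> L point = point ->
  lim (L (q x) @[x --> F]) = L (lim (q x @[x --> F])).
Proof.
move=> cL cK LK Lpt; have [qc|qd] := pselect (cvg (q x @[x --> F])).
  by apply: cvg_lim => //; apply: (cvg_comp _ _ qc); exact: cL.
rewrite (dvgP qd) Lpt; apply: dvgP => /cvg_ex[/= l Lql]; apply: qd.
apply/cvg_ex; exists (K l).
have -> : (fun x => q x) = (fun x => K (L (q x))).
  by apply/funext => x; rewrite LK.
exact: (cvg_comp _ _ Lql (cK l)).
Qed.

Lemma derive_section {R : realType} {E V W : normedModType R} (phi L : V -> W)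
    (K : W -> V) (F : E -> V) (x v : E) :
  (forall a u w, a *: (phi u - phi w) = L (a *: (u - w))) ->
  continuous L -> continuous K -> cancel L K -> L point = point ->
  'D_v (fun y => phi (F y)) x = L ('D_v F x).
Proof.
move=> phiL cL cK LK Lpt; rewrite /derive -(lim_section _ _ _ cL cK LK Lpt).
by under eq_fun do rewrite /= phiL.
Qed.

Lemma rV_point {R : realType} {n : nat} : (point : 'rV[R]_n) = 0.
Proof. by apply/matrixP => i j; rewrite !mxE. Qed.

Lemma derive_row_mx {R : realType} {E : normedModType R} {m n : nat}
    (t : 'rV[R]_m) (F : E -> 'rV[R]_n) (x v : E) :
  'D_v (fun y => row_mx t (F y)) x = row_mx 0 ('D_v F x).
Proof.
apply: (derive_section (row_mx t) (row_mx 0) rsubmx).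
- by move=> a u w; rewrite opp_row_mx add_row_mx subrr scale_row_mx scaler0.
- exact: continuous_row_mx0.
- exact: continuous_rsubmx.
- by move=> u; rewrite row_mxKr.
- by rewrite !rV_point row_mx0.
Qed.

Lemma derive_scale {R : realType} {E V : normedModType R} (c : R)
    (F : E -> V) (x v : E) : c != 0 -> (point : V) = 0 ->
  'D_v (fun y => c *: F y) x = c *: 'D_v F x.
Proof.
move=> c0 pt0.
apply: (derive_section (fun u => c *: u) (fun u => c *: u)
  (fun u => c^-1 *: u)).
- by move=> a u w; rewrite -scalerBr !scalerA mulrC.
- move=> u; exact: scaler_continuous.
- move=> u; exact: scaler_continuous.
- by move=> u; rewrite scalerA mulVf// scale1r.
- by rewrite pt0 scaler0.
Qed.

(** An equality of filters, and not only a convergence, so that it can be substituted inside a limit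
    that may diverge. The second inclusion comes from the first one applied to [c^-1]. *)
Lemma mul_dnbhs0 {R : realType} (c : R) : c != 0 -> c * h @[h --> 0^'] = 0^'.
Proof.
have sub (a : R) : a != 0 -> a * h @[h --> 0^'] --> (0 : R)^'.
  move=> a0 A; rewrite /dnbhs /within /= => A0.
  have := @mulrl_continuous R a 0 _.
  rewrite mulr0 => /(_ _ A0); rewrite !near_simpl /=.
  by apply: filterS => h /= + h0; apply; rewrite mulf_neq0.
move=> c0; apply/seteqP; split=> A; last exact: sub.
have cV0 : c^-1 != 0 by rewrite invr_eq0.
move=> /(sub _ cV0); rewrite /= !near_simpl.
by apply: filterS => h /=; rewrite mulrA mulfV// mul1r.
Qed.

Lemma derive_scale_dir {R : realType} {E V : normedModType R} (c : R)
    (F : E -> V) (x v : E) : c != 0 -> (point : V) = 0 ->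
  'D_(c *: v) F x = c *: 'D_v F x.
Proof.
move=> c0 pt0; rewrite {2}/derive -{1}(mul_dnbhs0 c c0) /derive.
rewrite -(lim_section (fun u => c *: u) (fun u => c^-1 *: u)).
- rewrite -fmap_comp; apply: eq_lim => h /=.
  rewrite !scalerA; congr (_ *: (F (_ *: _ + _) - _)); last exact: mulrC.
  by rewrite invfM mulrA mulfV// mul1r.
- move=> u; exact: scaler_continuous.
- move=> u; exact: scaler_continuous.
- by move=> u; rewrite scalerA mulVf// scale1r.
- by rewrite pt0 scaler0.
Qed.

Lemma derive_comp_mul {R : realType} {V : normedModType R} (c : R)
    (F : R -> V) (x v : R) :
  'D_v (fun y => F (c * y)) x = 'D_(c * v) F (c * x).
Proof.
rewrite /derive; apply: eq_lim => h /=.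
by rewrite /GRing.scale/= mulrDr mulrCA.
Qed.

Lemma derive1_comp_mul {R : realType} {n : nat} (c : R) (F : R -> 'rV[R]_n)
    (s : R) : c != 0 ->
  derive1 (fun y => F (c * y)) s = c *: derive1 F (c * s).
Proof.
move=> c0; rewrite !derive1E derive_comp_mul -[X in 'D_X _ _]/(c *: (1 : R)).
by rewrite derive_scale_dir// rV_point.
Qed.

(** * Stability of the classes C^k *)

Lemma Ck_on_eq {R : realType} {V W : normedModType R} (k : nat) (U : set V)
    (F G : V -> W) :
  open U -> (forall x, U x -> F x = G x) -> Ck_on k U F -> Ck_on k U G.
Proof.
move=> oU.
have near_eq (F' G' : V -> W) x : (forall y, U y -> F' y = G' y) -> U x ->
    \near x, F' x = G' x.
  by move=> FG Ux; apply: filterS FG _; exact: open_nbhs_nbhs.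
have cont (F' G' : V -> W) : (forall x, U x -> F' x = G' x) ->
    (forall x, U x -> {for x, continuous F'}) ->
    forall x, U x -> {for x, continuous G'}.
  move=> FG cF x Ux; rewrite /prop_for /continuous_at -FG//.
  by apply: cvg_trans (cF x Ux); apply: near_eq_cvg; exact: near_eq FG Ux.
elim: k F G => [|k IH] F G FG [cF dF]; split => //; try exact: cont FG cF.
move=> v; have [dFv CdF] := dF v; split.
  by move=> x Ux; apply: near_eq_derivable (dFv x Ux); exact: near_eq.
by apply: IH CdF => x Ux; apply: near_eq_derive; exact: near_eq.
Qed.

(** The derivative of the composite in direction [v] is the derivative of [F] in direction [c * v],
    again composed with the dilation, so the induction on [k] closes. *)
Lemma Ck_on_comp_mul {R : realType} {W : normedModType R} (k : nat) (U : set R)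
    (F : R -> W) (c : R) : c != 0 ->
  Ck_on k U F -> Ck_on k [set x | U (c * x)] (fun x => F (c * x)).
Proof.
move=> c0; have cont (F' : R -> W) :
    (forall x, U x -> {for x, continuous F'}) ->
    forall x, U (c * x) -> {for x, continuous (fun y => F' (c * y))}.
  move=> cF x /cF cFx; apply: continuous_comp => //.
  exact: mulrl_continuous.
elim: k F => [|k IH] F [cF dF]; split => //; try exact: cont.
move=> v; have [dFv /IH CdF] := dF (c * v); split.
  move=> x /dFv /cvg_ex[/= l dFx]; apply/cvg_ex; exists l; move: dFx.
  rewrite (eq_cvg _ _ (g := fun h =>
    h^-1 *: (F (c * (h *: v + x)) - F (c * x)))) // => h /=.
  by rewrite /GRing.scale/= mulrDr mulrCA.
have -> : (fun x => 'D_v (fun y => F (c * y)) x) =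
    fun x => 'D_(c * v) F (c * x).
  by apply/funext => x; exact: derive_comp_mul.
exact: CdF.
Qed.

(** Serves for projections such as [rsubmx], which have no left inverse. The derivative is therefore
    moved through [L] only on [U], where it exists, and [Ck_on_eq] transfers the result. *)
Lemma Ck_on_linear {R : realType} {V W W' : normedModType R} (k : nat)
    (U : set V) (F : V -> W) (L : {linear W -> W'}) :
  open U -> continuous L -> Ck_on k U F -> Ck_on k U (fun x => L (F x)).
Proof.
move=> oU cL; have cont (F' : V -> W) :
    (forall x, U x -> {for x, continuous F'}) ->
    forall x, U x -> {for x, continuous (fun y => L (F' y))}.
  by move=> cF x /cF cFx; apply: continuous_comp => //; exact: cL.
elim: k F => [|k IH] F [cF dF]; split => //; try exact: cont.
move=> v; have [dFv /IH CdF] := dF v.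
have dLF x : U x ->
    h^-1 *: (L (F (h *: v + x)) - L (F x)) @[h --> 0^'] --> L ('D_v F x).
  move=> /dFv dFx; have := cvg_comp _ _ dFx (cL _).
  rewrite (eq_cvg _ _ (g := fun h => h^-1 *: (L (F (h *: v + x)) - L (F x))))//.
  by move=> h; rewrite /= linearZ_LR linearB.
split; first by move=> x /dLF dLFx; apply/cvg_ex; exists (L ('D_v F x)).
by apply: Ck_on_eq CdF => // x /dLF dLFx; apply/esym/cvg_lim.
Qed.

(** * Christoffel symbols and curvature in one chart *)

Section Christoffel.
Context {R : realType} {n : nat} (g : 'rV[R]_n -> 'M[R]_n).

Lemma christoffel_form_scale (a b : R) (x u v : 'rV[R]_n) :
  christoffel_form g x (a *: u) (b *: v) = (a * b) *: christoffel_form g x u v.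
Proof.
apply/rowP => k; rewrite !mxE mulr_sumr; apply: eq_bigr => i _.
rewrite mulr_sumr; apply: eq_bigr => j _; rewrite !mxE.
by ring.
Qed.

Lemma christoffel_form0 (x v : 'rV[R]_n) : christoffel_form g x 0 v = 0.
Proof.
by have := christoffel_form_scale 0 1 x 0 v;
  rewrite scaler0 scale1r mul0r scale0r.
Qed.

(** Constant fields have zero bracket, and the covariant derivative of one along another is just the
    Christoffel form. *)
Lemma curvE (x u v w : 'rV[R]_n) : curv g x u v w =
  'D_u (fun y => christoffel_form g y v w) x
    + christoffel_form g x u (christoffel_form g x v w)
  - ('D_v (fun y => christoffel_form g y u w) x
    + christoffel_form g x v (christoffel_form g x u w)).
Proof.
have nabla_cst (a b : 'rV[R]_n) :
    nabla g (fun=> a) (fun=> b) = fun y => christoffel_form g y a b.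
  by apply/funext => y; rewrite /nabla derive_cst add0r.
rewrite /curv /riem !nabla_cst.
have -> : bracket (fun=> u) (fun=> v) = fun=> 0.
  by apply/funext => y; rewrite /bracket !derive_cst subrr.
by rewrite nabla_cst christoffel_form0 subr0.
Qed.

Lemma curv_scale (a b c : R) (x u v w : 'rV[R]_n) :
  a != 0 -> b != 0 -> c != 0 ->
  curv g x (a *: u) (b *: v) (c *: w) = (a * b * c) *: curv g x u v w.
Proof.
move=> a0 b0 c0; rewrite !curvE !christoffel_form_scale.
have E (p q s : R) (y z : 'rV[R]_n) : p != 0 -> q != 0 -> s != 0 ->
    'D_(p *: y) (fun t => christoffel_form g t (q *: z) (s *: w)) x =
    (p * q * s) *: 'D_y (fun t => christoffel_form g t z w) x.
  move=> p0 q0 s0; under eq_fun do rewrite christoffel_form_scale.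
  rewrite derive_scale_dir ?rV_point// derive_scale ?mulf_neq0 ?rV_point//.
  by rewrite scalerA mulrA.
by rewrite !E// !mulrA (mulrC b a) -!scalerDr -scalerBr.
Qed.

End Christoffel.

(** * Geometry of a warped product along a critical slice *)

Lemma derive_slice {R : realType} {V : normedModType R} {m n : nat}
    (F : 'rV[R]_(m + n) -> V) (t : 'rV[R]_m) (x v : 'rV[R]_n) :
  'D_(row_mx 0 v) F (row_mx t x) = 'D_v (fun y => F (row_mx t y)) x.
Proof.
apply: eq_lim => h /=.
by rewrite scale_row_mx add_row_mx scaler0 add0r.
Qed.

Lemma posdef_unitmx {R : realType} {n : nat} (A : 'M[R]_n) :
  (forall u : 'rV[R]_n, u != 0 -> 0 < inner A u u) -> A \in unitmx.
Proof.
move=> Apos; rewrite -row_free_unit -kermx_eq0; apply/rowV0P => u.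
move=> /sub_kermxP uA0; apply/eqP; apply: contraTT isT => /Apos.
by rewrite /inner uA0 mul0mx mxE ltxx.
Qed.

Section WarpedProduct.
Context {R : realType} {n : nat} (f : R -> R) (G : 'rV[R]_n -> 'M[R]_n) (t : R).
Hypotheses (ft0 : f t != 0) (df : derivable f t 1) (f't0 : derive1 f t = 0).

(** This is the chart metric of [robertson_walker], and [sl] is the inclusion of the slice at time
    [t]. *)
Let W (x : 'rV[R]_(1 + n)) : 'M[R]_(1 + n) :=
  block_mx (-1)%:M 0 0 (f (lsubmx x 0 0) ^+ 2 *: G (rsubmx x)).
Let sl (x : 'rV[R]_n) : 'rV[R]_(1 + n) := row_mx (const_mx t) x.

Lemma warped_slice x : W (sl x) = block_mx (-1)%:M 0 0 (f t ^+ 2 *: G x).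
Proof. by rewrite /W /sl row_mxKl row_mxKr mxE. Qed.

Lemma inner_warped_slice x u v :
  inner (W (sl x)) (row_mx 0 u) (row_mx 0 v) = f t ^+ 2 * inner (G x) u v.
Proof.
rewrite /inner warped_slice mul_row_block tr_row_mx mul_row_col !trmx0.
by rewrite !(mul0mx, mulmx0, add0r) -scalemxAr -scalemxAl mxE.
Qed.

Lemma dmetric_warped_space l a b x :
  dmetric W (rshift 1 l) (rshift 1 a) (rshift 1 b) (sl x) =
  f t ^+ 2 * dmetric G l a b x.
Proof.
rewrite /dmetric delta_mx_rshift derive_slice.
have f20 : f t ^+ 2 != 0 by rewrite expf_neq0.
apply: etrans (derive_scale (V := R) _ (fun y => G y a b) x _ f20 erefl).
by apply: eq_lim => h /=; rewrite !warped_slice !block_mxEdr !mxE.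
Qed.

Lemma dmetric_warped_mixed l a b x :
  dmetric W (rshift 1 l) (rshift 1 a) (lshift n b) (sl x) = 0.
Proof.
rewrite /dmetric delta_mx_rshift derive_slice.
under eq_fun do rewrite warped_slice block_mxEdl mxE.
exact: derive_cst.
Qed.

Lemma dmetric_warped_time l a b x :
  dmetric W (lshift n l) (rshift 1 a) (rshift 1 b) (sl x) = 0.
Proof.
have dft : is_derive t 1 f 0 by split => //; rewrite -derive1E.
(* The product rule shows that [f * f] scaled by [G x a b] has derivative 0 at [t]. The 0 of the
   goal is replaced by this derivative, and the difference quotients are then compared term by
   term. *)
have /(@derive_val _ _ _ _ _ _ _) := is_deriveZ (G x a b) (is_deriveM dft dft).
rewrite !scaler0 addr0 scaler0 => <-.
rewrite /dmetric delta_mx_lshift; apply: eq_lim => h /=.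
rewrite /W /sl scale_row_mx add_row_mx !row_mxKl !row_mxKr !block_mxEdr !mxE.
rewrite scaler0 add0r ord1 eqxx /= /GRing.scale/= /GRing.mul_fun /= !expr2.
by rewrite ![G x a b * _]mulrC.
Qed.

Lemma christoffel_form_warped x u v : G x \in unitmx ->
  christoffel_form W (sl x) (row_mx 0 u) (row_mx 0 v) =
  row_mx 0 (christoffel_form G x u v).
Proof.
move=> Gx; have Winv : invmx (W (sl x)) =
    block_mx (-1)%:M 0 0 (f t ^- 2 *: invmx (G x)).
  have f2 : f t ^+ 2 \is a GRing.unit by rewrite unitfE expf_neq0.
  have f2G : f t ^+ 2 *: G x \in unitmx by rewrite unitmxZ.
  rewrite warped_slice invmx_block_diag.
    by rewrite invmx_scalar invrN1 invmxZ.
  by rewrite block_diag_mx_unit f2G -scalemx1 unitmxZ ?unitmx1 ?unitrN1.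
(* The time components of both arguments vanish, so only spatial lower indices contribute. *)
have sumE k : christoffel_form W (sl x) (row_mx 0 u) (row_mx 0 v) 0 k =
    \sum_a \sum_b
      christoffel W k (rshift 1 a) (rshift 1 b) (sl x) * u 0 a * v 0 b.
  rewrite mxE big_split_ord/= [X in X + _]big1 ?add0r; last first.
    by move=> a _; apply: big1 => b _;
      rewrite row_mxEl [X in _ * X * _]mxE mulr0 mul0r.
  apply: eq_bigr => a _.
  rewrite big_split_ord/= [X in X + _]big1 ?add0r; last first.
    by move=> b _; rewrite row_mxEl [X in _ * X]mxE mulr0.
  by apply: eq_bigr => b _; rewrite !row_mxEr.
apply/rowP => k; rewrite sumE; case: (split_ordP k) => {}k ->.
  (* Time upper index: a spatial [l] meets the zero block of the inverse, and for the time [l] all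
     three metric derivatives vanish. *)
  rewrite row_mxEl mxE; apply: big1 => a _; apply: big1 => b _.
  rewrite /christoffel big_split_ord/= !big1 ?addr0 ?mulr0 ?mul0r// => l _.
    by rewrite Winv block_mxEur mxE !mul0r.
  rewrite !dmetric_warped_mixed dmetric_warped_time. 
  by rewrite !(addr0, subr0, mulr0).
(* Spatial upper index: the factor [f t ^- 2] of the inverse metric cancels the [f t ^+ 2] of the
   metric derivatives. *)
rewrite row_mxEr mxE; apply: eq_bigr => a _; apply: eq_bigr => b _.
do 2 congr (_ * _); rewrite /christoffel; congr (_ * _).
rewrite big_split_ord/= big1 ?add0r; last first.
  by move=> l _; rewrite Winv block_mxEdl mxE !mul0r.
apply: eq_bigr => l _; rewrite Winv block_mxEdr mxE !dmetric_warped_space.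
by field; rewrite ?ft0.
Qed.

(** Curvature differentiates the Christoffel form, so the agreement of the two forms is needed on a
    neighbourhood of [x]. The derivatives are all tangent to the slice, where [derive_slice]
    applies. *)
Lemma curv_warped (U : set 'rV[R]_n) x u v w : open U -> U x ->
  (forall y, U y -> G y \in unitmx) ->
  curv W (sl x) (row_mx 0 u) (row_mx 0 v) (row_mx 0 w) =
  row_mx 0 (curv G x u v w).
Proof.
move=> oU Ux Gunit; rewrite !curvE.
have dE (a b c : 'rV[R]_n) :
    'D_(row_mx 0 a) (fun y => christoffel_form W y (row_mx 0 b) (row_mx 0 c))
      (sl x) = row_mx 0 ('D_a (fun y => christoffel_form G y b c) x).
  rewrite derive_slice -(derive_row_mx 0); apply: near_eq_derive.
  apply: filterS (open_nbhs_nbhs (conj oU Ux)) => y Uy.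
  by rewrite -christoffel_form_warped ?Gunit.
have Gx := Gunit x Ux.
rewrite !dE !christoffel_form_warped// !add_row_mx opp_row_mx add_row_mx.
by rewrite !addr0 subrr.
Qed.

End WarpedProduct.

(** * Homogeneity of the tension field under a change of speed *)

Section Reparametrization.
Context {R : realType} {T : topologicalType} {n : nat} (N : metric_atlas R T n).
Context (alpha : R -> T) (c : R) (c0 : c != 0) (i : Defs.index N).

Let beta (s : R) : T := alpha (c * s).

Lemma velocity_comp_mul :
  velocity beta i = fun s => c *: velocity alpha i (c * s).
Proof. by apply/funext => s; rewrite /velocity -derive1_comp_mul. Qed.

Lemma nablaT_comp_mul j :
  nablaT beta i j = fun s => c ^+ j.+1 *: nablaT alpha i j (c * s).
Proof.
elim: j => [|j IH]; first by rewrite /nablaT /= velocity_comp_mul.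
apply/funext => s; rewrite /nablaT iterS -/(nablaT _ _ _) IH.
rewrite {1}/nabla_along velocity_comp_mul christoffel_form_scale -exprS.
rewrite iterS -/(nablaT _ _ _) /nabla_along scalerDr; congr (_ + _).
rewrite derive1E derive_scale ?expf_neq0 ?rV_point// -derive1E.
by rewrite derive1_comp_mul// scalerA -exprSr.
Qed.

Lemma tension_comp_mul r s : (2 <= r)%N ->
  tension beta r i s = c ^+ (2 * r) *: tension alpha r i (c * s).
Proof.
move=> r2; rewrite /tension scalerDr scaler_sumr; congr (_ + _).
  by rewrite nablaT_comp_mul; congr (_ ^+ _ *: _); lia.
(* The range of [l] keeps [2 * r - 3 - l] from being truncated at 0; the three exponents
   [2 * r - 2 - l], [l + 1] and 1 then add up to [2 * r]. *)
rewrite !big_nat; apply: eq_bigr => l /andP[_ lr].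
rewrite !nablaT_comp_mul velocity_comp_mul curv_scale ?expf_neq0//.
rewrite !scalerA mulrC -exprD -exprSr; congr (_ ^+ _ * _ *: _); lia.
Qed.

End Reparametrization.

(** * Curves contained in the slice *)

Section Slice.
Context {R : realType} {T : topologicalType} {n : nat} (N : metric_atlas R T n).
Context (J : set R) (f : R -> R) (t0 : R) (i : Defs.index N).
Context (gamma : R -> R * T) (alpha : R -> T) (U : set R).
Hypotheses (ft0 : f t0 != 0) (df : derivable f t0 1) (f't0 : derive1 f t0 = 0).
Hypotheses (oU : open U) (gammaE : forall s, U s -> gamma s = (t0, alpha s)).
Hypotheses (U_dom : forall s, U s -> dom i (alpha s)) (oi : open (cimage i)).
Hypothesis metric_unit : forall x, cimage i x -> metric i x \in unitmx.

Let RW := robertson_walker J N f.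
Let iRW : Defs.index RW := i.

Let coord_slice s : U s ->
  Defs.coord iRW (gamma s) = row_mx (const_mx t0) (Defs.coord i (alpha s)).
Proof. by move=> Us; rewrite /= gammaE. Qed.

Let nbhsU s : U s -> nbhs s U.
Proof. by move=> Us; exact: open_nbhs_nbhs. Qed.

Let cimageU s : U s -> cimage i (Defs.coord i (alpha s)).
Proof. by move=> Us; exists (alpha s) => //; exact: U_dom. Qed.

Lemma velocity_slice s : U s ->
  velocity gamma iRW s = row_mx 0 (velocity alpha i s).
Proof.
move=> Us; rewrite /velocity !derive1E -(derive_row_mx (const_mx t0)).
apply: near_eq_derive; apply: filterS (nbhsU s Us) => y Uy.
exact: coord_slice.
Qed.

(** By induction on [j] for all [s] in [U] at once: each order differentiates the identity of the
    previous order, which must hold near [s]; openness of [U] ensures this. *)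
Lemma nablaT_slice j s : U s ->
  nablaT gamma iRW j s = row_mx 0 (nablaT alpha i j s).
Proof.
elim: j s => [|j IH] s Us; first exact: velocity_slice.
rewrite /nablaT !iterS -!/(nablaT _ _ _) /nabla_along.
rewrite velocity_slice// IH// coord_slice//.
rewrite christoffel_form_warped//; last first.
  by apply: metric_unit; exact: cimageU.
rewrite !derive1E (_ : 'D_1 _ s = row_mx 0 ('D_1 (nablaT alpha i j) s)).
  by rewrite add_row_mx addr0.
rewrite -(derive_row_mx 0); apply: near_eq_derive.
by apply: filterS (nbhsU s Us) => y; exact: IH.
Qed.

Lemma tension_slice r s : U s ->
  tension gamma r iRW s = row_mx 0 (tension alpha r i s).
Proof.
move=> Us; rewrite /tension nablaT_slice//.
rewrite (eq_bigr (fun l => row_mx 0 ((-1) ^+ l *: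
    curv (metric i) (Defs.coord i (alpha s))
      (nablaT alpha i (2 * r - 3 - l)%N s) (nablaT alpha i l s) (velocity alpha i s)))); last first.
  move=> l _; rewrite !nablaT_slice// velocity_slice// coord_slice//.
  rewrite (curv_warped _ _ _ _ _ _ (cimage i))//; last exact: cimageU.
  by rewrite scale_row_mx scaler0.
have row_mxD :
    {morph row_mx (0 : 'rV[R]_1) : u v / (u : 'rV[R]_n) + v >-> u + v}.
  by move=> u v; rewrite add_row_mx addr0.
by rewrite -(big_morph _ row_mxD (row_mx0 _ _ _ _)) add_row_mx addr0.
Qed.

End Slice.

Theorem theorem1p29 (R : realType) (r : nat) (hr : (2 <= r)%N)
    (T : topologicalType) (n : nat) (N : metric_atlas R T n) (c : R)
    (hN : space_form N c)
    (J : set R) (hJo : open J) (hJi : is_interval J)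
    (f : R -> R) (hf : smooth_on J f) (hf0 : forall t, J t -> 0 < f t)
    (t0 : R) (ht0 : J t0) (hft0 : derive1 f t0 = 0)
    (I : set R) (hIo : open I) (hIi : is_interval I)
    (gamma : R -> R * T) (alpha : R -> T)
    (hys : smooth_curve (robertson_walker J N f) I gamma)
    (hyl : arc_length (robertson_walker J N f) I gamma)
    (hya : forall s, I s -> gamma s = (t0, alpha s)) :
  r_harmonic (robertson_walker J N f) I gamma r <->
  r_harmonic N [set s | I (f t0 * s)] (fun s => alpha (f t0 * s)) r.
Proof.
have c_gt0 : 0 < f t0 := hf0 t0 ht0.
have c0 : f t0 != 0 by rewrite gt_eqF.
have df : derivable f t0 1 by have [_ /(_ 1)[dJ _]] := hf 1%N; exact: dJ.
have [[_ [_ _ charts _]] [_ _ posdef _] _ _ _] := hN.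
have metric_unit (i : Defs.index N) x : cimage i x -> metric i x \in unitmx.
  by move=> ix; apply: posdef_unitmx => u; exact: posdef.
have [gamma_carrier gamma_smooth] := hys.
have alpha_cont s : I s -> {for s, continuous alpha}.
  move=> Is; have [_ gs] := gamma_carrier s Is.
  have gs2 : snd (gamma y) @[y --> s] --> alpha s.
    rewrite [alpha s](_ : _ = (gamma s).2); last by rewrite hya.
    by apply: (continuous_comp gs); exact: cvg_snd.
  apply: cvg_trans gs2; apply: near_eq_cvg.
  by apply: filterS (open_nbhs_nbhs (conj hIo Is)) => y Iy /=; rewrite hya.
have domE (i : Defs.index N) s : I s ->
    dom (m := robertson_walker J N f) i (gamma s) <-> dom i (alpha s).
  by move=> Is; rewrite hya//; split=> [[]|].
(* The parameters at which the curve lies over chart [i]: the open sets on which the slice lemmas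
   are applied. *)
pose U (i : Defs.index N) := I `&` alpha @^-1` dom i.
have oU i : open (U i).
  rewrite openE => s [Is ias]; have [oi _ _ _ _] := charts i.
  apply: filterI; first exact: open_nbhs_nbhs.
  by apply: alpha_cont Is _ _; exact: open_nbhs_nbhs.
have gammaU i s : U i s -> gamma s = (t0, alpha s) by case=> /hya.
have domU i s : U i s -> dom i (alpha s) by case.
have oimage (i : Defs.index N) : open (cimage i) by case: (charts i).
have alpha_smooth i : smooth_on (U i) (Defs.coord i \o alpha).
  move=> k; have UE :
      U i = I `&` gamma @^-1` dom (m := robertson_walker J N f) i.
    by apply/seteqP; split=> s [Is /(domE i s Is)].
  (* On [U i] the coordinates of [alpha] are the last [n] coordinates of [gamma], a linear image of
     a smooth map. *)
  apply: (Ck_on_eq k (U i) (fun s => rsubmx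
    ((Defs.coord (m := robertson_walker J N f) i \o gamma) s))) => //.
    by move=> s /gammaU /= ->; rewrite row_mxKr.
  apply: Ck_on_linear => //; first exact: continuous_rsubmx.
  by rewrite UE; exact: gamma_smooth.
set beta := fun s => alpha (f t0 * s).
have beta_smooth : smooth_curve N [set s | I (f t0 * s)] beta.
  split=> [s Is|i k]; last exact: Ck_on_comp_mul (alpha_smooth i k).
  have [[i _ /(domE i _ Is) ias] _] := gamma_carrier _ Is.
  split; first by exists i.
  apply: continuous_comp; last exact: alpha_cont.
  exact: mulrl_continuous.
have beta_arc : arc_length N [set s | I (f t0 * s)] beta.
  move=> s Is i ias; have Us : U i (f t0 * s) by [].
  (* The 1 on the right becomes the speed of [gamma] at [f t0 * s], so that two inner products are
     compared. *)
  rewrite -(hyl _ Is i); last exact/domE.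
  rewrite velocity_comp_mul//.
  rewrite (velocity_slice _ _ _ t0 _ _ alpha (U i) _ (gammaU i))//.
  rewrite [Defs.coord _ (gamma _)]
    (_ : _ = row_mx (const_mx t0) (Defs.coord i (beta s))); last by rewrite /= hya.
  rewrite inner_warped_slice /inner linearZ/= -!scalemxAl -scalemxAr scalerA.
  by rewrite mxE -expr2.
have slice r' i s : U i s ->
    tension (M := robertson_walker J N f) gamma r' i s =
    row_mx 0 (tension alpha r' i s).
  apply: (tension_slice _ _ _ t0) => //; [exact: gammaU|exact: domU|].
  exact: metric_unit.
have betaE i s :
    tension beta r i s = f t0 ^+ (2 * r) *: tension alpha r i (f t0 * s).
  exact: tension_comp_mul.
(* Smoothness and unit speed are known for both curves, which leaves the vanishing of the
   tensions. *)
split=> [[_ _ tau0]|[_ _ tau0]]; split=> //.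
- move=> s Is i ias; rewrite betaE.
  have /eqP := tau0 _ Is i (proj2 (domE i _ Is) ias).
  rewrite slice; last by [].
  by rewrite row_mx_eq0 => /andP[_ /eqP ->]; rewrite scaler0.
- move=> s Is i /(domE i s Is) ias; rewrite slice; last by [].
  (* The point [alpha s] is reached by [beta] at parameter [(f t0)^-1 * s]; the nonzero factor
     [f t0 ^+ (2 * r)] is then cancelled. *)
  have sE : f t0 * ((f t0)^-1 * s) = s by rewrite mulVKf.
  have := tau0 ((f t0)^-1 * s); rewrite /= /beta sE => /(_ Is i ias).
  rewrite -/beta betaE sE => /eqP.
  rewrite scaler_eq0 expf_eq0 (negbTE c0) andbF.
  by move=> /eqP ->; rewrite row_mx0.
Qed.
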